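(* Suppose that $K\subset X$ is a compact set. Then, for every pair of measures $\boldsymbol\mu,\boldsymbol\nu\in\mathcal P_\pi(\Omega\times K)$, it holds that $$W_{\pi,1}(\boldsymbol\mu,\boldsymbol\nu)=\sup\Big\{\int_\Omega\int_K\varphi(\omega,x)\,d(\mu_\omega-\nu_\omega)(x)\,d\pi(\omega)\;:\;\varphi\in\mathrm{Lip}_{\pi,1}(\Omega\times K,\mathbb R)\Big\},$$ where $\mathrm{Lip}_{\pi,1}(\Omega\times K,\mathbb R)$ is the collection of all Carathéodory mappings $\varphi:\Omega\times K\to\mathbb R$ such that, for $\pi$-almost every $\omega\in\Omega$, the function $\varphi(\omega,\cdot)$ is Lipschitz over $K$ with constant at most $1$.
   Context: $\Omega$ is a Polish space, $\pi$ a probability measure on $\Omega$, and $(\Omega,\mathcal A,\pi)$ the corresponding complete probability space. $(X,\|\cdot\|_X)$ is a separable Banach space. $\mathcal P_\pi(\Omega\times K)$ is the set of Borel probability measures $\boldsymbol\mu$ on $\Omega\times X$ concentrated on $\Omega\times K$ with first marginal $\pi$. Each has a $\pi$-a.e. unique Borel disintegration $\boldsymbol\mu=\int_\Omega\mu_\omega\,d\pi(\omega)$ with $\mu_\omega\in\mathcal P(K)$. $W_{\pi,1}(\boldsymbol\mu,\boldsymbol\nu):=\int_\Omega W_1(\mu_\omega,\nu_\omega)\,d\pi(\omega)$, where $W_1$ is the classical $1$-Wasserstein distance. A map $\varphi:\Omega\times K\to\mathbb R$ is Carathéodory if $\omega\mapsto\varphi(\omega,x)$ is $\pi$-measurable for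 all $x\in K$ and $x\mapsto\varphi(\omega,x)$ is continuous for $\pi$-a.e. $\omega$. *)

(* Defs.v *)
From HB Require Import structures.
From mathcomp Require Import all_boot all_order all_algebra.
From mathcomp Require Import all_classical all_reals all_analysis.
From mathcomp Require Import measurable_realfun.

Set Implicit Arguments.
Unset Strict Implicit.
Unset Printing Implicit Defensive.
Import Order.TTheory GRing.Theory Num.Theory.
Import numFieldNormedType.Exports.

Local Open Scope classical_set_scope.
Local Open Scope ring_scope.

Definition separable (T : topologicalType) : Prop :=
  exists2 D : set T, countable D & dense D.

(* Only the topology of [T] is fixed: the complete metric inducing it is not
   part of the data. *)
Definition polish (R : realType) (T : topologicalType) : Prop :=
  separable T /\
  exists dist : T -> T -> R,
    [/\ forall x y, dist x y = 0 <-> x = y,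
        forall x y, dist x y = dist y x,
        forall x y z, dist x z <= dist x y + dist y z,
        forall x (A : set T), nbhs x A <->
          exists2 e : R, 0 < e & [set y | dist x y < e] `<=` A &
        forall u : nat -> T,
          (forall e : R, 0 < e ->
             exists N, forall m n, (N <= m)%N -> (N <= n)%N ->
               dist (u m) (u n) < e) ->
          exists l : T, u @ \oo --> l].

(* [T] with its Borel sigma-algebra. On a product [(S * T)%type] this is the
   Borel sigma-algebra of the product topology. *)
Notation borel T := (g_sigma_algebraType (@open T)).

Section completion.
Context d (T : measurableType d) (R : realType).
Variable mu : {measure set T -> \bar R}.

(* [T] with the completion of its sigma-algebra, whose elements are the sets
   [A `|` N] with [A] measurable and [N] contained in a measurable set of
   measure zero. *)
Definition completed := g_sigma_algebraType (completed_algebra_gen mu).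

HB.instance Definition _ := Measurable.on completed.

(* The outer measure of [mu] takes the value [mu A] on [A `|` N]. *)
Definition completion : set completed -> \bar R := (mu^*)%mu.

Lemma completed_caratheodory :
  (measurable : set (set completed)) `<=` (mu^*)%mu.-cara.-measurable.
Proof.
apply: smallest_sub.
  split => //; first by move=> A mA; rewrite setTD; exact: measurableC.
  by move=> F mF; exact: bigcupT_measurable.
move=> _ [A mA [N [B [mB B0 NB]]] <-].
apply: measurableU; first exact: caratheodory_measurable_mu_ext.
apply: le_caratheodory_measurable => /= X.
have N0 : ((mu^*)%mu N = 0)%E.
  apply/eqP; rewrite eq_le outer_measure_ge0 andbT -B0.
  by rewrite -measurable_mu_extE// le_outer_measure.
apply: (@le_trans _ _ ((mu^*)%mu N + (mu^*)%mu (X `&` ~` N))%E).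
  by rewrite leeD2r// le_outer_measure//; exact: subIsetr.
by rewrite N0 add0e le_outer_measure//; exact: subIsetl.
Qed.

Let completion0 : completion set0 = 0%E.
Proof. exact: mu_ext0. Qed.

Let completion_ge0 A : (0 <= completion A)%E.
Proof. exact: mu_ext_ge0. Qed.

Let completion_semi_sigma_additive : semi_sigma_additive completion.
Proof.
move=> F mF tF mUF; apply: caratheodory_measure_sigma_additive => //.
- by move=> i; exact: completed_caratheodory.
- exact: completed_caratheodory.
Qed.

HB.instance Definition _ := isMeasure.Build _ _ _ completion
  completion0 completion_ge0 completion_semi_sigma_additive.

Lemma completionE A N : measurable A -> mu.-negligible N ->
  completion (A `|` N) = mu A.
Proof.
move=> mA [B [mB B0 NB]]; rewrite -(measurable_mu_extE mu mA); apply/eqP.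
have N0 : ((mu^*)%mu N <= 0)%E.
  by rewrite -B0 -(measurable_mu_extE mu mB) le_outer_measure.
rewrite eq_le; apply/andP; split; last exact: le_outer_measure (@subsetUl _ A N).
by rewrite (le_trans (outer_measureU2 (mu^*)%mu A N))// -[leRHS]adde0 leeD2l.
Qed.

End completion.
Arguments completed {d T R} mu.
Arguments completion {d T R} mu _.

Section wasserstein.
Context (R : realType) (X : normedModType R).

Definition couplings (mu nu : {measure set (borel X) -> \bar R}) :
    set (probability (borel (X * X)%type) R) :=
  [set gamma | forall A : set (borel X), measurable A ->
     gamma (fst @^-1` A) = mu A /\ gamma (snd @^-1` A) = nu A].

Definition W1 (mu nu : {measure set (borel X) -> \bar R}) : \bar R :=
  ereal_inf [set (\int[gamma]_z `|z.1 - z.2|%:E)%E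
            | gamma in couplings mu nu].

End wasserstein.

Section fibered.
Context (R : realType) (Omega : ptopologicalType) (X : normedModType R).
Variables (P : probability (borel Omega) R) (K : set X).

Definition measures_over : set (probability (borel (Omega * X)%type) R) :=
  [set mu | mu (~` ([set: Omega] `*` K)) = 0%E /\
     forall A : set (borel Omega), measurable A -> mu (fst @^-1` A) = P A].

(* Being a kernel, [k] is Borel: [w |-> k w B] is Borel for every Borel [B]. *)
Definition disintegration (mu : probability (borel (Omega * X)%type) R)
    (k : R.-pker (borel Omega) ~> (borel X)) : Prop :=
  {ae P, forall w, k w (~` K) = 0%E} /\
  forall E : set (borel (Omega * X)%type), measurable E ->
    mu E = (\int[P]_w k w [set x | E (w, x)])%E.

Definition Wpi1 (k l : R.-pker (borel Omega) ~> (borel X)) : \bar R :=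
  (\int[completion P]_w W1 (k w) (l w))%E.

(* Maps on [Omega * K] are represented by total functions on [Omega * X], whose
   values outside [Omega * K] are never used. *)
Definition caratheodory_map (phi : Omega -> X -> R) : Prop :=
  (forall x, K x -> measurable_fun [set: completed P] (phi ^~ x)) /\
  {ae P, forall w, {within K, continuous (phi w)}}.

Definition Lippi1 : set (Omega -> X -> R) :=
  [set phi | caratheodory_map phi /\ {ae P, forall w, 1.-lipschitz_K (phi w)}].

(* The integral over [K] against the signed measure [k w - l w] is the
   difference of the two integrals, both finite for almost every [w]. *)
Definition dual_pairing (k l : R.-pker (borel Omega) ~> (borel X))
    (phi : Omega -> X -> R) : \bar R :=
  (\int[completion P]_w
     (\int[k w]_(x in K) (phi w x)%:E - \int[l w]_(x in K) (phi w x)%:E))%E.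

End fibered.

(* Main.v *)
(* The difficulty is the inequality [W_{pi,1} <= sup]. For a finite metric space,
   Kantorovich duality is the Hahn-Banach theorem applied to the sublinear
   functional [h |-> inf {u.p + v.q | h i j <= u i + v j}] on matrices: a linear
   functional below it is integration against a coupling of [p] and [q].
   Cutting the compact [K] into finitely many Borel pieces of diameter [< 2 e]
   around net points [x_j], a coupling of the masses of the pieces lifts to a
   coupling of the measures (a weighted sum of restrictions of the product
   measure), and the dual variable [v] yields the 1-Lipschitz function
   [min_j (|y - x_j| - v_j)]. Hence, up to [6 e], [W_1 (mu_w, nu_w)] is attained
   on the countable family of these functions with rational [v], and choosing
   for each [w] the first almost optimal member of the family is a measurable
   selection, which gives a Caratheodory competitor. *)
Require Import Defs.
From HB Require Import structures.
From mathcomp Require Import all_boot all_order all_algebra.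
From mathcomp Require Import all_classical all_reals all_analysis.
From mathcomp Require Import measurable_realfun.
From mathcomp Require Import ring lra.

Set Implicit Arguments.
Unset Strict Implicit.
Unset Printing Implicit Defensive.
Import Order.TTheory GRing.Theory Num.Theory.
Import numFieldNormedType.Exports.

Local Open Scope classical_set_scope.
Local Open Scope ring_scope.

(** * Hahn-Banach argument along finitely many vectors *)

Section sublinear.
Context (R : realType) (V : lmodType R).
Implicit Types (p q : V -> R) (a x : V).

Definition sublinear p :=
  (forall x y, p (x + y) <= p x + p y) /\
  (forall t x, 0 <= t -> p (t *: x) <= t * p x).

Lemma sublinear0 p : sublinear p -> p 0 = 0.
Proof.
move=> [pD pZ]; apply/eqP; rewrite eq_le; apply/andP; split.
  by have := pZ 0 0 (lexx _); rewrite scale0r mul0r.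
by have := pD 0 0; rewrite addr0; lra.
Qed.

Lemma sublinear_opp_ge p x : sublinear p -> - p x <= p (- x).
Proof.
by move=> sp; have := sp.1 x (- x); rewrite subrr sublinear0//; lra.
Qed.

(* For sublinear [q], [q (- a) <= - q a] means that [q] is linear along [a]. *)
Lemma sublinear_along p a : sublinear p ->
  exists2 q, sublinear q /\ (forall x, q x <= p x) & q (- a) <= - p a.
Proof.
move=> sp; have [pD pZ] := sp.
(* The classical Hahn-Banach infimum of [p (x + t a) - t p a] over [t >= 0]: [t = 0] gives [q <= p],
   and [t = 1] at [- a] gives the bound on [q (- a)]. *)
pose E x := [set p (x + t *: a) - t * p a | t in [set t : R | 0 <= t]].
pose q x := inf (E x).
(* Homogeneity is assumed in one direction only; scaling back by [t^-1] gives the other. *)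
have pZge t : 0 <= t -> t * p a <= p (t *: a).
  rewrite le_eqVlt => /predU1P[<-|t0]; first by rewrite scale0r mul0r sublinear0.
  have := pZ t^-1 (t *: a); rewrite invr_ge0 => /(_ (ltW t0)).
  by rewrite scalerA mulVf ?gt_eqF// scale1r ler_pdivlMl.
have Elb x : lbound (E x) (- p (- x)).
  move=> _ [t /= t0 <-].
  have := pD (x + t *: a) (- x); rewrite [x + _]addrC addrK.
  by have := pZge t t0; lra.
have Einf x : has_inf (E x).
  split; last by exists (- p (- x)).
  by exists (p (x + 0 *: a) - 0 * p a); exists 0 => //=.
have qle x t : 0 <= t -> q x <= p (x + t *: a) - t * p a.
  move=> t0; apply: ge_inf; first by have [] := Einf x.
  by exists t.
exists q; last first.
  by have := qle (- a) 1 ler01; rewrite scale1r addNr mul1r sublinear0// add0r.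
split; last first.
  by move=> x; have := qle x 0 (lexx _); rewrite scale0r addr0 mul0r subr0.
split.
- move=> x y; rewrite -lerBlDr; apply: lb_le_inf; first by have [] := Einf x.
  move=> _ [t /= t0 <-]; rewrite lerBlDr -lerBlDl.
  apply: lb_le_inf; first by have [] := Einf y.
  move=> _ [s /= s0 <-].
  have := qle (x + y) (t + s) (addr_ge0 t0 s0).
  have := pD (x + t *: a) (y + s *: a).
  by rewrite addrACA -scalerDl; lra.
- move=> s x; rewrite le_eqVlt => /predU1P[<-|s0].
    rewrite scale0r mul0r; have := qle 0 0 (lexx _).
    by rewrite scale0r addr0 mul0r subr0 (sublinear0 sp).
  rewrite -ler_pdivrMl//; apply: lb_le_inf; first by have [] := Einf x.
  move=> _ [t /= t0 <-]; rewrite ler_pdivrMl//.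
  have := qle (s *: x) (s * t) (mulr_ge0 (ltW s0) t0).
  have := pZ s (x + t *: a) (ltW s0).
  by rewrite scalerDr scalerA; lra.
Qed.

(** Linearity along a vector survives the later steps: if [q <= p'], then
    [q (- a) <= p' (- a) <= - p a <= - q a]. So the vectors can be treated one at a time. *)
Lemma sublinear_along_seq p (s : seq V) : sublinear p ->
  exists2 q, sublinear q /\ (forall x, q x <= p x) &
    forall a, a \in s -> q (- a) <= - q a.
Proof.
elim: s p => [|a s IH] p sp; first by exists p.
have [p' [sp' p'p] p'a] := sublinear_along a sp.
have [q [sq qp'] qs] := IH p' sp'.
exists q; first by split=> // x; exact: le_trans (p'p x).
move=> b; rewrite inE => /predU1P[->|]; last exact: qs.
rewrite (le_trans (qp' _))// (le_trans p'a)// lerN2.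
exact: le_trans (p'p a).
Qed.

(** A negative coefficient is moved onto [- v i], where [q] is controlled by assumption. Applied to
    both [c] and [- c], the bound makes [q] linear on the span of the [v i]. *)
Lemma sublinear_sum q (I : finType) (c : I -> R) (v : I -> V) : sublinear q ->
  (forall i, q (- v i) <= - q (v i)) ->
  q (\sum_i c i *: v i) <= \sum_i c i * q (v i).
Proof.
move=> sq qv; elim/big_ind2 : _ => [|x1 x2 y1 y2 h1 h2|i _].
- by rewrite sublinear0.
- by rewrite (le_trans (sq.1 _ _))// lerD.
have [c0|c0] := leP 0 (c i); first exact: sq.2.
rewrite -[c i]opprK scaleNr -scalerN mulNr -mulrN.
apply: (le_trans (sq.2 _ _ _)); first by rewrite oppr_ge0 ltW.
by rewrite ler_pM2l ?oppr_gt0.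
Qed.

End sublinear.

(** * Kantorovich duality on a finite set *)

Section finite_duality.
Context (R : realType) (n : nat).
Variables (p q : 'I_n -> R).
Hypotheses (p0 : forall i, 0 <= p i) (q0 : forall i, 0 <= q i).
Hypotheses (p1 : \sum_i p i = 1) (q1 : \sum_i q i = 1).

Let dual_set (h : 'M[R]_n) := [set r : R | exists u v : 'I_n -> R,
  (forall i j, h i j <= u i + v j) /\ r = \sum_i u i * p i + \sum_j v j * q j].

Let dual h := inf (dual_set h).

Let sumpq (u v : 'I_n -> R) : \sum_i u i * p i + \sum_j v j * q j =
  \sum_i \sum_j (u i + v j) * (p i * q j).
Proof.
transitivity (\sum_i \sum_j (u i * p i * q j) +
  \sum_i \sum_j (v j * q j * p i)).
  congr (_ + _).
    by apply: eq_bigr => i _; rewrite -mulr_sumr q1 mulr1.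
  rewrite exchange_big; apply: eq_bigr => j _.
  by rewrite -mulr_sumr p1 mulr1.
rewrite -big_split; apply: eq_bigr => i _.
rewrite -big_split; apply: eq_bigr => j _.
by rewrite /=; ring.
Qed.

Let dual_inf h : has_inf (dual_set h).
Proof.
split.
  pose M := \sum_i \sum_j `|h i j|.
  exists (\sum_i M * p i + \sum_j 0 * q j), (fun=> M), (fun=> 0); split => // i j.
  rewrite addr0 (le_trans (ler_norm _))// /M.
  rewrite (bigD1 i)//= (bigD1 j)//= -addrA lerDl addr_ge0//.
    by apply: sumr_ge0.
  by apply: sumr_ge0 => k _; apply: sumr_ge0.
(* Weak duality for the product coupling: it bounds all dual values from below, so the infimum is
   finite. *)
exists (\sum_i \sum_j h i j * (p i * q j)) => _ [u [v [huv ->]]].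
rewrite sumpq; apply: ler_sum => i _; apply: ler_sum => j _.
by apply: ler_wpM2r; [exact: mulr_ge0|].
Qed.

Let dual_le (h : 'M[R]_n) (u v : 'I_n -> R) : (forall i j, h i j <= u i + v j) ->
  dual h <= \sum_i u i * p i + \sum_j v j * q j.
Proof.
move=> huv; apply: ge_inf; first by have [] := dual_inf h.
by exists u, v.
Qed.

Let dual_sublinear : sublinear dual.
Proof.
split.
- move=> h k; rewrite -lerBlDr; apply: lb_le_inf; first by have [] := dual_inf h.
  move=> _ [u [v [huv ->]]]; rewrite lerBlDr -lerBlDl.
  apply: lb_le_inf; first by have [] := dual_inf k.
  move=> _ [u' [v' [huv' ->]]]; rewrite lerBlDl.
  apply: (le_trans (@dual_le _ (u \+ u') (v \+ v') _)).
    by move=> i j; rewrite mxE/= addrACA lerD.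
  by rewrite -!big_split/=; apply: ler_sum => i _; lra.
- move=> s h; rewrite le_eqVlt => /predU1P[<-|s0].
    rewrite scale0r mul0r (le_trans (@dual_le _ (fun=> 0) (fun=> 0) _))//.
      by move=> i j; rewrite mxE addr0.
    by rewrite !big1 ?addr0// => i _; rewrite mul0r.
  rewrite -ler_pdivrMl//; apply: lb_le_inf; first by have [] := dual_inf h.
  move=> _ [u [v [huv ->]]]; rewrite ler_pdivrMl//.
  apply: (le_trans (@dual_le _ (fun i => s * u i) (fun j => s * v j) _)).
    by move=> i j; rewrite mxE -mulrDr ler_pM2l.
  by rewrite -!big_split/= mulr_sumr; apply: ler_sum => i _; lra.
Qed.

(** The coupling [w] is read on the matrix units from a linear functional [L] below [dual]. It is
    nonnegative because [dual] is at most 0 on nonpositive matrices, and its marginals come from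
    [dual] on row and column indicators of either sign. The error [e] pays for potentials that are
    only nearly optimal. *)
Lemma finite_kantorovich (c : 'M[R]_n) (e : R) : 0 < e ->
  exists (w : 'M[R]_n) (u v : 'I_n -> R),
    [/\ forall i j, 0 <= w i j,
        forall i, \sum_j w i j = p i,
        forall j, \sum_i w i j = q j,
        forall i j, u i + v j <= c i j &
        \sum_i \sum_j w i j * c i j <=
          \sum_i u i * p i + \sum_j v j * q j + e].
Proof.
move=> e0.
(* Starting along [- c] gives [L0 c <= - dual (- c)], which passes to every [L] below [L0] and makes
   [w] optimal for the cost [c]. *)
have [L0 [sL0 L0d] L0c] := sublinear_along (- c) dual_sublinear.
pose D := fun ij : 'I_n * 'I_n => delta_mx ij.1 ij.2 : 'M[R]_n.
have [L [sL LL0] LD] := sublinear_along_seq (map D (enum predT)) sL0.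
have {}LD ij : L (- D ij) <= - L (D ij).
  by apply/LD/map_f; rewrite mem_enum.
pose w := \matrix_(i, j) L (delta_mx i j).
have Ldual h : L h <= dual h by exact: le_trans (LL0 h) (L0d h).
have LE (h : 'M[R]_n) : L h = \sum_i \sum_j w i j * h i j.
  have hE : h = \sum_(ij : 'I_n * 'I_n) h ij.1 ij.2 *: D ij.
    rewrite -(pair_bigA _ (fun i j => h i j *: D (i, j))).
    exact: matrix_sum_delta.
  have sE : \sum_i \sum_j w i j * h i j =
      \sum_(ij : 'I_n * 'I_n) h ij.1 ij.2 * L (D ij).
    rewrite pair_bigA/=; apply: eq_bigr => -[i j] _ /=.
    by rewrite mxE mulrC.
  apply/eqP; rewrite eq_le sE; apply/andP; split.
    by rewrite {1}hE; exact: sublinear_sum.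
  (* The reverse inequality is the same estimate for [- h]. *)
  have := @sublinear_sum _ _ L _ (fun ij : 'I_n * 'I_n => - h ij.1 ij.2) D sL LD.
  under eq_bigr do rewrite scaleNr; under [X in _ <= X]eq_bigr do rewrite mulNr.
  rewrite !sumrN -hE; have := sublinear_opp_ge h sL; lra.
(* The potentials [s 1_i] and [0] are admissible with equality; [s = 1] and [s = -1] will pin down
   the row sum. *)
have dualrow i s : dual (s *: \matrix_(k, l) (k == i)%:R) <= s * p i.
  apply: (le_trans (@dual_le _ (fun k => s * (k == i)%:R) (fun=> 0) _)).
    by move=> k l; rewrite !mxE addr0.
  rewrite [X in _ + X]big1 ?addr0; last by move=> j _; rewrite mul0r.
  rewrite (bigD1 i)//= eqxx mulr1 big1 ?addr0// => k /negPf ->.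
  by rewrite mulr0 mul0r.
have dualcol j s : dual (s *: \matrix_(k, l) (l == j)%:R) <= s * q j.
  apply: (le_trans (@dual_le _ (fun=> 0) (fun l => s * (l == j)%:R) _)).
    by move=> k l; rewrite !mxE add0r.
  rewrite [X in X + _]big1 ?add0r; last by move=> k _; rewrite mul0r.
  rewrite (bigD1 j)//= eqxx mulr1 big1 ?addr0// => k /negPf ->.
  by rewrite mulr0 mul0r.
have wrow i s : \sum_j w i j * s = L (s *: \matrix_(k, l) (k == i)%:R).
  rewrite LE [RHS](bigD1 i)//= [X in _ + X]big1 ?addr0; last first.
    by move=> k /negPf ki; rewrite big1// => l _; rewrite !mxE ki !mulr0.
  by apply: eq_bigr => l _; rewrite !mxE eqxx mulr1.
have wcol j s : \sum_i w i j * s = L (s *: \matrix_(k, l) (l == j)%:R).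
  rewrite LE exchange_big/= [RHS](bigD1 j)//= [X in _ + X]big1 ?addr0; last first.
    by move=> k /negPf ki; rewrite big1// => l _; rewrite !mxE ki !mulr0.
  by apply: eq_bigr => l _; rewrite !mxE eqxx mulr1.
(* Nearly optimal potentials above [- c]; their opposites lie below [c]. *)
have [_ [u [v [huv ->]]] duv] := inf_adherent e0 (dual_inf (- c)).
exists w, (fun i => - u i), (fun j => - v j); split.
- move=> i j; rewrite mxE.
  suff : L (- delta_mx i j) <= 0.
    by have := sublinear_opp_ge (- delta_mx i j) sL; rewrite opprK; lra.
  rewrite (le_trans (Ldual _))// (le_trans (@dual_le _ (fun=> 0) (fun=> 0) _))//.
    by move=> k l; rewrite !mxE addr0 oppr_le0.
  by rewrite !big1 ?addr0// => k _; rewrite mul0r.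
- move=> i; apply/eqP; rewrite eq_le; apply/andP; split.
    have := le_trans (Ldual _) (dualrow i 1).
    by rewrite -wrow mul1r; under eq_bigr do rewrite mulr1.
  have := le_trans (Ldual _) (dualrow i (-1)).
  by rewrite -wrow mulN1r; under eq_bigr do rewrite mulrN1; rewrite sumrN; lra.
- move=> i; apply/eqP; rewrite eq_le; apply/andP; split.
    have := le_trans (Ldual _) (dualcol i 1).
    by rewrite -wcol mul1r; under eq_bigr do rewrite mulr1.
  have := le_trans (Ldual _) (dualcol i (-1)).
  by rewrite -wcol mulN1r; under eq_bigr do rewrite mulrN1; rewrite sumrN; lra.
- by move=> i j; have := huv i j; rewrite mxE; lra.
rewrite -LE; under eq_bigr do rewrite mulNr.
under [X in _ + X + _]eq_bigr do rewrite mulNr.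
rewrite !sumrN; move: duv; rewrite -/(dual _).
have := LL0 c; move: L0c; rewrite opprK; lra.
Qed.

End finite_duality.

(** * Comparison of integrals of arbitrary functions *)

Section ae_le_integral.
Local Open Scope ereal_scope.
Context d (T : measurableType d) (R : realType).
Variable m : {measure set T -> \bar R}.
Implicit Types f g : T -> \bar R.

Import HBNNSimple.

(* Integrals of nonnegative functions are suprema over the simple functions
   below them, so no measurability is needed here. *)
Lemma ge0_ae_le_integral_lower f g : (forall x, 0 <= f x) -> (forall x, 0 <= g x) ->
  {ae m, forall x, f x <= g x} -> \int[m]_x f x <= \int[m]_x g x.
Proof.
move=> f0 g0 [N [mN N0 fgN]].
rewrite ge0_integralTE//; apply: ge_ereal_sup => _ [h /= hf <-].
(* Cutting [h] off on the null set [N] keeps its integral and puts it below [g] everywhere. *)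
pose h' := proj_nnsfun h (measurableC mN).
rewrite (_ : sintegral m h = sintegral m h').
  rewrite ge0_integralTE//; apply: ereal_sup_ubound; exists h' => //= x.
  rewrite mindicE; have [xN|xN] := pselect (N x).
    by rewrite memNset ?mulr0//; exact.
  rewrite mem_set ?mulr1//; apply: (le_trans (hf x)).
  by apply: contrapT => fg; apply/xN/fgN.
rewrite -!integralT_nnsfun; apply: ae_eq_integral => //.
- exact/measurable_EFinP.
- exact/measurable_EFinP.
exists N; split => // x /= /not_implyP[_].
apply: contra_notP => xN; rewrite mindicE mem_set ?mulr1//.
Qed.

(** This lets [W1 (k w) (l w)] be compared under the integral over [w], although no measurability of
    this function of [w] is at hand. *)
Lemma ae_le_integral_lower f g :
  {ae m, forall x, f x <= g x} -> \int[m]_x f x <= \int[m]_x g x.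
Proof.
move=> fg; rewrite integralE [leRHS]integralE; apply: leeB.
  apply: ge0_ae_le_integral_lower => //.
  by apply: filterS fg => x fgx; rewrite !funeposE ge_max !le_max fgx lexx orbT.
apply: ge0_ae_le_integral_lower => //.
by apply: filterS fg => x fgx; rewrite !funenegE ge_max !le_max leeN2 fgx lexx orbT.
Qed.

End ae_le_integral.

Section concentrated.
Local Open Scope ereal_scope.
Context d (T : measurableType d) (R : realType) (m : {measure set T -> \bar R}).
Variable K : set T.
Hypotheses (mK : measurable K) (mK0 : m (~` K) = 0).
Implicit Types f g : T -> \bar R.

Lemma le_integral_concentrated f g : (forall y, K y -> f y <= g y) ->
  \int[m]_y f y <= \int[m]_y g y.
Proof.
move=> fg; apply: ae_le_integral_lower.
exists (~` K); split => //; first exact: measurableC.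
by move=> y; apply: contra_not => /= Ky; exact: fg.
Qed.

Lemma integral_concentrated f : \int[m]_(y in K) f y = \int[m]_y f y.
Proof.
rewrite integral_mkcond; apply/eqP; rewrite eq_le.
by apply/andP; split; apply: le_integral_concentrated => y Ky;
  rewrite patchE mem_set.
Qed.

End concentrated.

(** * Borel sets, and the Borel sigma-algebra of a product *)

Section borel.
Context (T : ptopologicalType).

Lemma open_borel (U : set T) : open U -> measurable (U : set (borel T)).
Proof. exact: sub_sigma_algebra. Qed.

Lemma closed_borel (F : set T) : closed F -> measurable (F : set (borel T)).
Proof. by move/closed_openC/open_borel/measurableC; rewrite setCK. Qed.

Lemma measurable_fun_borel d (S : measurableType d) (f : S -> borel T) :
  (forall U : set T, open U -> measurable (f @^-1` U)) -> measurable_fun setT f.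
Proof.
move=> mf; apply: (@measurability _ _ S (borel T) setT f (@open T) erefl).
by move=> _ [U oU <-]; rewrite setTI; exact: mf.
Qed.

Lemma within_continuous_borel (R : realType) (K : set T) (f : T -> R) :
  closed K -> {within K, continuous f} ->
  measurable_fun (K : set (borel T)) f.
Proof.
move=> cK /continuousP cf; apply: (measurability _ (RGenOpens.measurableE R)).
move=> _ [_ [a [b ->] <-]].
have /open_subspaceP [V oV VD] :=
  cf _ (@interval_open R (BRight a) (BLeft b) erefl erefl).
by rewrite setIC -VD; apply: measurableI; [exact: open_borel|exact: closed_borel].
Qed.

End borel.

Section separable.
Context (R : realType) (X : normedModType R).
Hypothesis X_separable : separable X.

Lemma separable_dense_seq : exists u : nat -> X,
  forall x (e : R), 0 < e -> exists n, ball (u n) e x.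
Proof.
have [D /pcard_surjP[f fD] Dd] := X_separable.
exists f => x e e0.
have [||y [xy Dy]] := Dd (ball x e); [|exact: ball_open|].
  by exists x; exact: ballxx.
by have [n _ fn] := fD _ Dy; exists n; rewrite fn; exact: ball_sym.
Qed.

(** By separability, an open set of the product is a countable union of boxes of balls centered on a
    dense sequence, hence lies in the product sigma-algebra. *)
Lemma measurable_id_borelX :
  measurable_fun [set: borel X * borel X]
    (id : borel X * borel X -> borel (X * X)%type).
Proof.
apply: (@measurability _ _ _ (borel (X * X)%type) setT _ (@open (X * X)%type) erefl).
move=> _ [U oU <-]; rewrite setTI preimage_id.
have [u ud] := separable_dense_seq.
pose B i n := ball (u i) n.+1%:R^-1 : set X.
have mB i n : measurable (B i n : set (borel X)).
  by apply: open_borel; exact: ball_open.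
pose F i j n : set (borel X * borel X) :=
  [set z | (B i n `*` B j n) z /\ B i n `*` B j n `<=` U].
have mF i j n : measurable (F i j n).
  have [h|h] := pselect (B i n `*` B j n `<=` U).
    rewrite (_ : F i j n = B i n `*` B j n).
      exact: measurableX.
    by apply/seteqP; split => // z [].
  rewrite (_ : F i j n = set0) //.
  by apply/seteqP; split => // z [].
rewrite (_ : U = \bigcup_i \bigcup_j \bigcup_n F i j n).
  by do 3 apply: bigcupT_measurable => ?.
apply/seteqP; split => [[x y] Uxy|z [i _ [j _ [n _ [Bz]]]]]; last exact.
have : nbhs (x, y) U by exact: open_nbhs_nbhs.
case/nbhs_ballP => e /= e0 exyU.
(* A ball of radius below [e / 2] that contains [x] is contained in the ball of radius [e] around
   [x]. *)
have [n] := ltr_add_invr (divr_gt0 e0 (ltr0Sn _ 1)); rewrite add0r => ne.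
have [i ui] := ud x n.+1%:R^-1 ltac:(by []).
have [j uj] := ud y n.+1%:R^-1 ltac:(by []).
exists i => //; exists j => //; exists n => //; split => // -[x' y'] [/= xi yj].
apply: exyU; split => /=.
  rewrite (splitr e).
  apply: (@ball_triangle _ _ (u i)).
    by apply/ball_sym; apply: le_ball ui; exact/ltW.
  by apply: le_ball xi; exact/ltW.
rewrite (splitr e).
apply: (@ball_triangle _ _ (u j)).
  by apply/ball_sym; apply: le_ball uj; exact/ltW.
by apply: le_ball yj; exact/ltW.
Qed.

End separable.

(** * From a coupling of cell masses to a coupling of measures *)

Section coupling.
Context (R : realType) (X : normedModType R).
Hypothesis X_separable : separable X.
Variables (mu nu : probability (borel X) R) (n : nat) (t : X -> 'I_n.+1).
Hypothesis mt : forall i, measurable (t @^-1` [set i] : set (borel X)).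
Variable w : 'M[R]_n.+1.
Hypothesis w0 : forall i j, 0 <= w i j.

Let A i : set (borel X) := t @^-1` [set i].
Let p i := fine (mu (A i)).
Let q i := fine (nu (A i)).
Hypothesis wrow : forall i, \sum_j w i j = p i.
Hypothesis wcol : forall j, \sum_i w i j = q j.

(** The density of the coupling with respect to the product measure on a cell. On a cell of zero
    mass, division by zero makes it 0. *)
Let r i j := w i j / (p i * q j).

Let p0 i : 0 <= p i. Proof. exact: fine_ge0. Qed.
Let q0 i : 0 <= q i. Proof. exact: fine_ge0. Qed.
Let pE i : (p i)%:E = mu (A i).
Proof. by rewrite fineK// fin_num_measure//; exact: mt. Qed.
Let qE i : (q i)%:E = nu (A i).
Proof. by rewrite fineK// fin_num_measure//; exact: mt. Qed.

Let r0 i j : 0 <= r i j.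
Proof. by rewrite divr_ge0// mulr_ge0. Qed.

Let mAA i j : measurable (A i `*` A j : set (borel X * borel X)).
Proof. by apply: measurableX; exact: mt. Qed.

Let piece i j : {measure set (borel X * borel X) -> \bar R} :=
  mscale (NngNum (r0 i j)) (mrestr (mu \x nu)%E (mAA i j)).

Let mixture : {measure set (borel X * borel X) -> \bar R} :=
  msum (fun i => msum (fun j => piece (inord i) (inord j)) n.+1) n.+1.

Let mixtureX (B C : set (borel X)) : measurable B -> measurable C ->
  mixture (B `*` C) =
  (\sum_i \sum_j (r i j)%:E * (mu (B `&` A i) * nu (C `&` A j)))%E.
Proof.
move=> mB mC; rewrite /mixture/= /msum; apply: eq_bigr => i _.
rewrite /= /msum; apply: eq_bigr => j _.
rewrite !inord_val /piece /= /mscale/= /mrestr -setXI.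
by rewrite product_measure1E//; apply: measurableI => //; exact: mt.
Qed.

(** A cell of zero mass carries no weight, since [w i j] is a nonnegative term of a sum equal to
    [p i] or to [q j]. *)
Let rpq i j : r i j * (p i * q j) = w i j.
Proof.
have [pq|pq0] := eqVneq (p i * q j) 0; last by rewrite divfK.
rewrite pq mulr0; apply/esym/eqP; rewrite eq_le w0 andbT.
move: pq => /eqP; rewrite mulf_eq0 => /orP[/eqP pi0|/eqP qj0].
  by rewrite -pi0 -wrow (bigD1 j)//= lerDl sumr_ge0.
by rewrite -qj0 -wcol (bigD1 i)//= lerDl sumr_ge0.
Qed.

Let sum_fibers (m : probability (borel X) R) B : measurable B ->
  (\sum_i m (B `&` A i) = m B)%E.
Proof.
move=> mB; have UE : \big[setU/set0]_(i < n.+1) (B `&` A i) = B.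
  rewrite -bigcup_mkord_ord; apply/seteqP; split => [x [i _ []]//|x Bx].
  by exists (t x); [exact: ltn_ord|split => //; rewrite /A/= inord_val].
rewrite -[in RHS]UE measure_semi_additive_ord//.
- by move=> i; apply: measurableI => //; exact: mt.
- by move=> i j _ _ [x [[_ <-] [_ <-]]].
- by rewrite UE.
Qed.

Let mixturel B : measurable B -> mixture (B `*` setT) = mu B.
Proof.
move=> mB; rewrite mixtureX// -[RHS]sum_fibers//; apply: eq_bigr => i _.
transitivity (mu (B `&` A i) * (\sum_j (r i j * q j)%:E))%E.
  rewrite ge0_sume_distrr; last by move=> j _; rewrite lee_fin mulr_ge0.
  by apply: eq_bigr => j _; rewrite setTI (EFinM (r i j)) qE muleCA.
have [pi0|pi0] := eqVneq (p i) 0.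
  rewrite (_ : mu (B `&` A i) = 0)%E ?mul0e//.
  apply: (subset_measure0 _ (mt i)) => //.
    by apply: measurableI => //; exact: mt.
  by have := pE i; rewrite pi0 => /esym; exact.
(* After multiplication by [p i], this is the row condition on [w]. *)
rewrite sumEFin (_ : \sum_j _ = 1) ?mule1//.
apply: (mulfI pi0); rewrite mulr1 mulr_sumr -[RHS]wrow; apply: eq_bigr => j _.
by rewrite mulrCA rpq.
Qed.

Let mixturer B : measurable B -> mixture (setT `*` B) = nu B.
Proof.
move=> mB; rewrite mixtureX// -[RHS]sum_fibers// exchange_big/=.
apply: eq_bigr => j _.
transitivity (nu (B `&` A j) * (\sum_i (r i j * p i)%:E))%E.
  rewrite ge0_sume_distrr; last by move=> i _; rewrite lee_fin mulr_ge0.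
  by apply: eq_bigr => i _; rewrite setTI (EFinM (r i j)) pE muleA muleC.
have [qj0|qj0] := eqVneq (q j) 0.
  rewrite (_ : nu (B `&` A j) = 0)%E ?mul0e//.
  apply: (subset_measure0 _ (mt j)) => //.
    by apply: measurableI => //; exact: mt.
  by have := qE j; rewrite qj0 => /esym; exact.
rewrite sumEFin (_ : \sum_i _ = 1) ?mule1//.
apply: (mulfI qj0); rewrite mulr1 mulr_sumr -[RHS]wcol; apply: eq_bigr => i _.
by rewrite mulrCA [q j * _]mulrC rpq.
Qed.

Let mixtureA i j : mixture (A i `*` A j) = (w i j)%:E.
Proof.
rewrite mixtureX; [|exact: mt|exact: mt].
have AE k l : k != l -> A l `&` A k = set0.
  move=> /eqP kl; apply/seteqP; split => // x [/= xk xl].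
  by apply: kl; rewrite -xk -xl.
rewrite (bigD1 i)//= [X in (_ + X)%E]big1 ?adde0; last first.
  by move=> k ki; apply: big1 => l _; rewrite AE// measure0 mul0e mule0.
rewrite (bigD1 j)//= [X in (_ + X)%E]big1 ?adde0; last first.
  by move=> k kj; rewrite (AE k j)// measure0 !mule0.
by rewrite !setIid -pE -qE -!EFinM rpq.
Qed.

Lemma exists_coupling : exists2 g, couplings mu nu g &
  forall i j, g (A i `*` A j) = (w i j)%:E.
Proof.
have mix1 : mixture setT = 1%E.
  by rewrite -setXTT mixturel// probability_setT.
pose P : probability (borel X * borel X)%type R :=
  HB.pack (Measure.sort mixture)
    (Measure_isProbability.Build _ _ _ (Measure.sort mixture) mix1).
(* The mixture lives on the product sigma-algebra; its image under the identity is a measure on the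
   Borel sets of [X * X], as [couplings] requires. *)
pose iX : {mfun (borel X * borel X)%type >-> borel (X * X)%type} :=
  HB.pack id (isMeasurableFun.Build _ _ _ _ _ (measurable_id_borelX X_separable)).
exists (distribution P iX : probability _ R).
  move=> B mB; rewrite /= /distribution /pushforward/=; split.
    rewrite -[RHS]mixturel//; congr (mixture _).
    by apply/seteqP; split => [z|z []]//=.
  rewrite -[RHS]mixturer//; congr (mixture _).
  by apply/seteqP; split => [z|z []]//=.
by move=> i j; exact: mixtureA.
Qed.

End coupling.

Section integral_fibers.
Context d (T : measurableType d) (R : realType) (I : finType).
Variables (m : probability T R) (t : T -> I).
Hypothesis mt : forall i, measurable (t @^-1` [set i]).

Lemma integral_fibers (g : I -> R) :
  (\int[m]_y (g (t y))%:E = (\sum_i g i * fine (m (t @^-1` [set i])))%:E)%E.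
Proof.
transitivity (\int[m]_y (\sum_i (g i)%:E * (\1_(t @^-1` [set i]) y)%:E))%E.
  apply: eq_integral => y _; rewrite (bigD1 (t y))//= big1 ?adde0.
    by rewrite indicE mem_set// mule1.
  by move=> i /eqP ti; rewrite indicE memNset ?mule0// => /= /esym.
have intA i : m.-integrable setT (fun y => (\1_(t @^-1` [set i]) y)%:E).
  exact: integrable_indic.
rewrite integral_sum//; last by move=> i; exact: integrableZl.
rewrite -sumEFin; apply: eq_bigr => i _.
rewrite integralZl// integral_indic// setIT EFinM fineK//.
exact: fin_num_measure.
Qed.

Lemma sum_fibers1 : \sum_i fine (m (t @^-1` [set i])) = 1.
Proof.
have := integral_fibers (fun=> 1); rewrite integral_cst//= probability_setT mule1.
by move=> [->]; apply: eq_bigr => i _; rewrite mul1r.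
Qed.

End integral_fibers.

(** * Approximate Kantorovich-Rubinstein duality on a compact set *)

Section cone_min.
Context (R : realType) (X : normedModType R) (n : nat).
Variables (x : 'I_n.+1 -> X) (s : 'I_n.+1 -> R).

(** The c-transform of [s] for the distance cost. The initial value of the minimum repeats the term
    of index 0. *)
Definition cone_min y : R :=
  \big[Order.min/ `|y - x ord0| - s ord0]_(j < n.+1) (`|y - x j| - s j).

Lemma cone_min_le j y : cone_min y <= `|y - x j| - s j.
Proof. exact: bigmin_le. Qed.

Lemma le_cone_min a y : (forall j, a <= `|y - x j| - s j) -> a <= cone_min y.
Proof. by move=> h; apply/bigmin_geP; split. Qed.

Lemma cone_min_lipschitz y z : `|cone_min y - cone_min z| <= `|y - z|.
Proof.
suff h a b : cone_min a - `|a - b| <= cone_min b.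
  by rewrite ler_norml; have := h y z; have := h z y; rewrite [`|z - y|]distrC; lra.
apply: le_cone_min => j; have := cone_min_le j a.
have := ler_distD b a (x j); lra.
Qed.

Lemma cone_min_continuous : continuous cone_min.
Proof.
move=> y; apply/cvgrPdist_lt => e e0.
near=> z; rewrite (le_lt_trans (cone_min_lipschitz _ _))//.

Unshelve. all: by end_near. Qed.

End cone_min.

Section couplings.
Context (R : realType) (X : normedModType R).

Lemma measurable_fst_borel : measurable_fun [set: borel (X * X)%type]
  (fst : borel (X * X)%type -> borel X).
Proof.
apply: measurable_fun_borel => U oU; apply: sub_sigma_algebra.
by apply: open_comp => // z _; exact: cvg_fst.
Qed.

Lemma measurable_snd_borel : measurable_fun [set: borel (X * X)%type]
  (snd : borel (X * X)%type -> borel X).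
Proof.
apply: measurable_fun_borel => U oU; apply: sub_sigma_algebra.
by apply: open_comp => // z _; exact: cvg_snd.
Qed.

Lemma couplings_ae (K : set X) (mu nu : {measure set (borel X) -> \bar R}) g :
  closed K -> mu (~` K) = 0%E -> nu (~` K) = 0%E -> couplings mu nu g ->
  {ae g, forall z, K z.1 /\ K z.2}.
Proof.
move=> cK muK nuK cg.
have mCK : measurable (~` K : set (borel X)).
  by apply: measurableC; exact: closed_borel.
have [g1 g2] := cg _ mCK.
have m1 := measurable_fst_borel measurableT mCK.
have m2 := measurable_snd_borel measurableT mCK.
rewrite !setTI in m1 m2.
exists (fst @^-1` (~` K) `|` snd @^-1` (~` K)); split.
- exact: measurableU.
- by apply: null_set_setU; rewrite /= ?g1 ?g2.
- by move=> z /= /not_andP; case=> ?; [left|right].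
Qed.

End couplings.

Section kantorovich_rubinstein.
Context (R : realType) (X : normedModType R).
Hypothesis X_separable : separable X.
Variables (K : set X) (e : R) (n : nat) (x : 'I_n.+1 -> X).
Hypotheses (cK : closed K) (e0 : 0 < e).
Hypothesis xK : forall y, K y -> exists i, `|y - x i| < e.

(** The net point chosen for [y] depends only on the finite vector recording which balls contain
    [y], so the fibers of [t] are finite unions of Boolean combinations of balls. *)
Let near_pt (b : {ffun 'I_n.+1 -> bool}) : 'I_n.+1 :=
  odflt ord0 [pick i | b i].
Let t y := near_pt [ffun i => `|y - x i| < e].

Let dist_t y : K y -> `|y - x (t y)| < e.
Proof.
move=> /xK[i yi]; rewrite /t /near_pt; case: pickP => [j|/(_ i)]; rewrite ffunE//.
by rewrite yi.
Qed.

Let mt i : measurable (t @^-1` [set i] : set (borel X)).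
Proof.
rewrite (_ : t @^-1` [set i] = \bigcup_(b in [set b | near_pt b = i])
    \bigcap_(j in [set: 'I_n.+1]) [set y | (`|y - x j| < e) = b j]).
  apply: fin_bigcup_measurable => // b _; apply: fin_bigcap_measurable => // j _.
  have mB : measurable ([set y | `|y - x j| < e] : set (borel X)).
    apply: open_borel; rewrite (_ : [set _ | _] = ball (x j) e).
      exact: ball_open.
    by rewrite -ball_normE/=; apply/seteqP; split => z /=; rewrite distrC.
  case: (b j).
    by rewrite (_ : [set _ | _] = [set y | `|y - x j| < e]).
  rewrite (_ : [set _ | _] = ~` [set y | `|y - x j| < e]); first exact: measurableC.
  by apply/seteqP; split => z /= => [->//|/negP/negbTE].
apply/seteqP; split => [y ty|y [b bi by_]].
  exists [ffun i => `|y - x i| < e] => // j _ /=; by rewrite ffunE.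
rewrite /= /t -bi; congr near_pt; apply/ffunP => j; rewrite ffunE.
exact: by_.
Qed.

Let mK : measurable (K : set (borel X)).
Proof. exact: closed_borel. Qed.

(** The error [6 * e] adds up as follows: [e] from finite duality, [2 * e] for moving both ends of
    the coupling to the net, [e] for moving the point under [mu], and [2 * e] under [nu], for the
    move and for rounding [v] to rationals. *)
Lemma W1_le_cone_min (mu nu : probability (borel X) R) :
  mu (~` K) = 0%E -> nu (~` K) = 0%E ->
  exists s : {ffun 'I_n.+1 -> rat},
  (W1 mu nu <= \int[mu]_(y in K) (cone_min x (ratr \o s) y)%:E -
               \int[nu]_(y in K) (cone_min x (ratr \o s) y)%:E + (6 * e)%:E)%E.
Proof.
move=> muK nuK.
pose A i : set (borel X) := t @^-1` [set i].
pose p i := fine (mu (A i)); pose q i := fine (nu (A i)).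
have p1 : \sum_i p i = 1 by exact: (sum_fibers1 mu mt).
have q1 : \sum_i q i = 1 by exact: (sum_fibers1 nu mt).
have p0 i : 0 <= p i by exact: fine_ge0.
have q0 i : 0 <= q i by exact: fine_ge0.
pose c := \matrix_(i, j) `|x i - x j|.
have [w [u [v [w0 wrow wcol uvc wcuv]]]] := finite_kantorovich p0 q0 p1 q1 c e0.
have [g cg gA] := exists_coupling X_separable mt w0 wrow wcol.
(* Rounding down keeps the lower bound on the [mu] side intact, so that it costs [e] on the [nu]
   side only. *)
have /choice[s sv] j : exists s : rat, v j - e < ratr s < v j.
  have /rat_in_itvoo[s] : v j - e < v j by rewrite ltrBlDr ltrDl.
  by rewrite in_itv/= => ?; exists s.
exists [ffun j => s j].
set f := cone_min _ _.
have fge : ((\sum_i u i * p i - e)%:E <= \int[mu]_(y in K) (f y)%:E)%E.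
  have -> : \sum_i u i * p i - e = \sum_i (u i - e) * p i.
    rewrite -[X in _ - X]mulr1 -[X in _ - _ * X]p1 mulr_sumr -sumrB.
    by apply: eq_bigr => i _; ring.
  rewrite -(integral_fibers mu mt) (integral_concentrated mK muK).
  apply: (le_integral_concentrated mK muK) => y Ky; rewrite lee_fin.
  apply: le_cone_min => j /=; rewrite ffunE.
  have := dist_t Ky; have := uvc (t y) j; rewrite mxE.
  have /andP[_ ] := sv j; have := ler_distD y (x (t y)) (x j).
  rewrite [`|x (t y) - y|]distrC; lra.
have fle : (\int[nu]_(y in K) (f y)%:E <= (2 * e - \sum_j v j * q j)%:E)%E.
  have -> : 2 * e - \sum_j v j * q j = \sum_j (2 * e - v j) * q j.
    rewrite -[X in X - _]mulr1 -[X in _ * X - _]q1 mulr_sumr -sumrB.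
    by apply: eq_bigr => i _; ring.
  rewrite -(integral_fibers nu mt) (integral_concentrated mK nuK).
  apply: (le_integral_concentrated mK nuK) => y Ky; rewrite lee_fin.
  rewrite (le_trans (cone_min_le _ _ (t y) _))//=.
  rewrite ffunE; have := dist_t Ky; have /andP[+ _] := sv (t y); lra.
have gcost : (\int[g]_z `|z.1 - z.2|%:E <=
    (\sum_i \sum_j w i j * c i j + 2 * e)%:E)%E.
  pose t2 (z : X * X) := (t z.1, t z.2).
  have t2E ij : t2 @^-1` [set ij] = A ij.1 `*` A ij.2.
    apply/seteqP; split => [z /= <-//|z [/= z1 z2]].
    by rewrite /t2 z1 z2 -surjective_pairing.
  have mt2 ij : measurable (t2 @^-1` [set ij] : set (borel (X * X)%type)).
    rewrite t2E -[A ij.1 `*` _]/(fst @^-1` A ij.1 `&` snd @^-1` A ij.2).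
    apply: measurableI; rewrite -[X in measurable X]setTI.
      by apply: measurable_fst_borel => //; exact: mt.
    by apply: measurable_snd_borel => //; exact: mt.
  have -> : \sum_i \sum_j w i j * c i j + 2 * e =
      \sum_ij (c ij.1 ij.2 + 2 * e) * fine (g (t2 @^-1` [set ij])).
    rewrite -[X in _ + X]mulr1 -[X in _ + _ * X]p1 mulr_sumr.
    rewrite [RHS](eq_bigr (fun ij => (c ij.1 ij.2 + 2 * e) * w ij.1 ij.2)); last first.
      by move=> ij _; rewrite t2E gA.
    rewrite -(pair_bigA _ (fun i j => (c i j + 2 * e) * w i j)).
    rewrite -big_split/=; apply: eq_bigr => i _; rewrite -[p i]wrow mulr_sumr.
    by rewrite -big_split; apply: eq_bigr => j _ /=; ring.
  rewrite -(integral_fibers _ mt2).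
  apply: ae_le_integral_lower; have := couplings_ae cK muK nuK cg.
  apply: (@filterS _ _ (ae_filter_ringOfSetsType g)) => z [/dist_t K1 /dist_t K2].
  rewrite lee_fin mxE/=.
  have := ler_distD (x (t z.1)) z.1 z.2.
  have := ler_distD (x (t z.2)) (x (t z.1)) z.2.
  rewrite [`|x (t z.2) - z.2|]distrC; lra.
apply: (@le_trans _ _ (\int[g]_z `|z.1 - z.2|%:E)%E).
  by apply: ereal_inf_lbound; exists g.
apply: (le_trans gcost).
apply: (@le_trans _ _
  ((\sum_i u i * p i - e) - (2 * e - \sum_j v j * q j) + 6 * e)%:E).
  by rewrite lee_fin; move: wcuv; rewrite -/(p _) -/(q _); lra.
by rewrite EFinD leeD2r// EFinB leeB.
Qed.

End kantorovich_rubinstein.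

(** * Measurable selection, completion and finite nets *)

Section measurable_selection.
Context d (T : measurableType d).

Lemma measurable_least_index (S : nat -> set T) :
  (forall m, measurable (S m)) ->
  exists2 N : T -> nat, forall m, measurable (N @^-1` [set m]) &
    forall w, (exists m, S m w) -> S (N w) w.
Proof.
move=> mS.
(* Points in no [S m] are sent to index 0, so that a least index exists everywhere. *)
pose S' m := if m is 0%N then S 0%N `|` ~` \bigcup_m S m else S m.
have mS' m : measurable (S' m).
  case: m => [|m]; last exact: mS.
  apply: measurableU => //; apply: measurableC; exact: bigcupT_measurable.
have exS' w : exists m, `[< S' m w >].
  have [[m Sm]|nS] := pselect (exists m, S m w).
    exists m; apply/asboolP; case: m Sm => [|m] Sm //; by left.
  by exists 0%N; apply/asboolP; right => -[m _ Sm]; apply: nS; exists m.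
pose N w := ex_minn (exS' w).
exists N.
  move=> m; rewrite (_ : _ @^-1` _ = S' m `\` \big[setU/set0]_(j < m) S' j).
    by apply: measurableD => //; exact: bigsetU_measurable.
  rewrite -bigcup_mkord; apply/seteqP; split => [w /= <-|w /= [Sm nS]]; rewrite /N.
    case: ex_minnP => k /asboolP Sk kmin; split => // -[j /= jk /asboolP/kmin].
    by rewrite leqNgt jk.
  case: ex_minnP => k /asboolP Sk kmin; apply/eqP; rewrite eqn_leq.
  rewrite kmin ?andTb; last exact/asboolP.
  by rewrite leqNgt; apply/negP => km; apply: nS; exists k.
move=> w [m Sm]; rewrite /N; case: ex_minnP => -[|k] /asboolP //= [//|nS].
by exfalso; apply: nS; exists m.
Qed.

Lemma measurable_fun_index d' (U : measurableType d') (N : T -> nat)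
    (f : nat -> T -> U) :
  (forall m, measurable (N @^-1` [set m])) ->
  (forall m, measurable_fun setT (f m)) ->
  measurable_fun setT (fun w => f (N w) w).
Proof.
move=> mN mf _ B mB; rewrite setTI.
rewrite (_ : _ @^-1` B = \bigcup_m (N @^-1` [set m] `&` f m @^-1` B)).
  apply: bigcupT_measurable => m; apply: measurableI; first exact: mN.
  by rewrite -[X in measurable X]setTI; exact: mf.
apply/seteqP; split => [w Bw|w [m _ [/= <-]]//].
by exists (N w).
Qed.

End measurable_selection.

Section completion.
Context d (T : measurableType d) (R : realType) (mu : {measure set T -> \bar R}).

Lemma measurable_completed (A : set T) :
  measurable A -> measurable (A : set (completed mu)).
Proof.
move=> mA; apply: sub_sigma_algebra; exists A => //.
by exists set0; [exact: negligible_set0|rewrite setU0].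
Qed.

Lemma measurable_fun_completed d' (U : measurableType d') (f : T -> U) :
  measurable_fun setT f -> measurable_fun [set: completed mu] f.
Proof.
move=> mf _ B mB; rewrite setTI; apply: measurable_completed.
by rewrite -[X in measurable X]setTI; exact: mf.
Qed.

Lemma completion_measurableE (A : set T) : measurable A -> completion mu A = mu A.
Proof.
by move=> mA; rewrite -[A]setU0 completionE// ?setU0//; exact: negligible_set0.
Qed.

Lemma ae_completion (Q : T -> Prop) :
  {ae mu, forall w, Q w} -> {ae completion mu, forall w, Q w}.
Proof.
move=> [N [mN N0 QN]]; exists N; split => //; first exact: measurable_completed.
by rewrite -[RHS]N0; exact: completion_measurableE.
Qed.

End completion.

Section finite_net.
Context (R : realType) (X : normedModType R).

Lemma compact_finite_net (K : set X) (e : R) : compact K -> 0 < e ->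
  exists (n : nat) (x : 'I_n.+1 -> X), forall y, K y -> exists i, `|y - x i| < e.
Proof.
move=> cK e0; move: cK; rewrite compact_cover => /(_ _ setT (fun x => ball x e)).
case=> [x _|y _|D _ KD]; first exact: ball_open.
  by exists y => //; exact: ballxx.
pose s := finmap.enum_fset D.
(* The last index gives the default value [0] of [nth], an extra point that keeps the net nonempty
   even for empty [K]. *)
exists (size s), (fun i => nth 0 s i) => y /KD[z /= zD].
rewrite -ball_normE/= distrC => yz.
have iD : (index z s < size s)%N by rewrite index_mem.
by exists (Ordinal (leqW iD)); rewrite /= nth_index.
Qed.

End finite_net.

(** * The easy inequality on a single fiber *)

Section lower_bound.
Context (R : realType) (X : normedModType R).

(** Against any coupling [g], the difference of integrals is the integral of [phi z.1 - phi z.2], at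
    most [|z.1 - z.2|] for [g]-almost every [z]. *)
Lemma dual_le_W1 (K : set X) (mu nu : {measure set (borel X) -> \bar R})
    (phi : X -> R) :
  compact K -> mu (~` K) = 0%E -> nu (~` K) = 0%E ->
  {within K, continuous phi} -> 1.-lipschitz_K phi ->
  (\int[mu]_(x in K) (phi x)%:E - \int[nu]_(x in K) (phi x)%:E <= W1 mu nu)%E.
Proof.
move=> comK muK nuK cphi lphi.
have cK : closed K by apply: compact_closed => //; exact: norm_hausdorff.
have mK : measurable (K : set (borel X)) by exact: closed_borel.
apply: le_ereal_inf_tmp => _ [g cg <-].
(* The extension of [phi] by 0 is bounded and Borel on all of [X], hence integrable after
   composition with the projections. *)
pose psi : borel X -> R := phi \_ K.
have mpsi : measurable_fun setT psi.
  by apply/measurable_restrict => //; rewrite setTI; exact: within_continuous_borel.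
have [M psiM] : exists M, forall y, `|psi y| <= M.
  have /compact_bounded[M [_ phiM]] := continuous_compact cphi comK.
  exists (Num.max 0 (M + 1)) => y; rewrite /psi patchE.
  case: ifPn => [/set_mem Ky|_].
    by rewrite le_max; apply/orP; right; apply: phiM; [rewrite ltrDl|exists y].
  by rewrite normr0 le_max lexx.
have intg (h : borel (X * X)%type -> borel X) : measurable_fun setT h ->
    g.-integrable setT (EFin \o (psi \o h)).
  move=> mh; apply: measurable_bounded_integrable => //.
  - by rewrite ltey_eq fin_num_measure.
  - exact: measurableT_comp.
  - exists M; split; first exact: num_real.
    by move=> r Mr z _; exact: le_trans (psiM _) (ltW Mr).
have int_psi (k : {measure set (borel X) -> \bar R})
    (h : borel (X * X)%type -> borel X) :
    measurable_fun setT h -> (forall A, measurable A -> g (h @^-1` A) = k A) ->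
    (\int[k]_(x in K) (phi x)%:E = \int[g]_z (psi (h z))%:E)%E.
  move=> mh gk; transitivity (\int[k]_x (psi x)%:E)%E.
    rewrite integral_mkcond; apply: eq_integral => x _.
    by rewrite /psi !patchE; case: ifP.
  transitivity (\int[pushforward g h]_x (psi x)%:E)%E.
    by apply: eq_measure_integral => A mA _; rewrite -gk.
  rewrite integral_pushforward//; first exact/measurable_EFinP.
  by rewrite preimage_setT; exact: intg.
rewrite (int_psi _ _ (@measurable_fst_borel R X) (fun A mA => (cg A mA).1)).
rewrite (int_psi _ _ (@measurable_snd_borel R X) (fun A mA => (cg A mA).2)).
rewrite -integralB_EFin//; last 2 first.
- exact: (intg _ (@measurable_fst_borel R X)).
- exact: (intg _ (@measurable_snd_borel R X)).
apply: ae_le_integral_lower; have := couplings_ae cK muK nuK cg.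
apply: (@filterS _ _ (ae_filter_ringOfSetsType g)) => z [K1 K2].
rewrite /psi !patchE !mem_set// -EFinB lee_fin.
rewrite (le_trans (ler_norm _))//.
by have := lphi z (conj K1 K2); rewrite /= mul1r.
Qed.

End lower_bound.

(** * Integration of the fiberwise duality over the base *)

Section unit_mass.
Context d (T : measurableType d) (R : realType) (m : {measure set T -> \bar R}).
Hypothesis m1 : m setT = 1%E.

(* The proof argument lets the probability structure be found by unification. *)
Definition unit_mass of m setT = 1%E : set T -> \bar R := m.

HB.instance Definition _ := Measure.on (unit_mass m1).
HB.instance Definition _ :=
  Measure_isProbability.Build _ _ _ (unit_mass m1) m1.

End unit_mass.

Section fibered_duality.
Context (R : realType) (Omega : ptopologicalType) (X : normedModType R).
Hypothesis X_separable : separable X.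
Variables (P : probability (borel Omega) R) (K : set X).
Hypothesis K_compact : compact K.
Variables (k l : R.-pker (borel Omega) ~> (borel X)).
Hypotheses (kK : {ae P, forall w, k w (~` K) = 0%E})
  (lK : {ae P, forall w, l w (~` K) = 0%E}).

Let cK : closed K.
Proof. by apply: compact_closed => //; exact: norm_hausdorff. Qed.

Let mK : measurable (K : set (borel X)).
Proof. exact: closed_borel. Qed.

Let aeP : Filter (almost_everywhere (completion P)).
Proof. exact: ae_filter_ringOfSetsType. Qed.

Let klK : {ae completion P, forall w, k w (~` K) = 0%E /\ l w (~` K) = 0%E}.
Proof.
apply: ae_completion.
exact: (@filterI _ _ (ae_filter_ringOfSetsType P) _ _ kK lK).
Qed.

Lemma dual_pairing_le_Wpi1 phi : Lippi1 P K phi ->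
  (dual_pairing P K k l phi <= Wpi1 P k l)%E.
Proof.
move=> [[_ cphi] lphi]; apply: ae_le_integral_lower.
have := @filterI _ _ aeP _ _ klK
  (@filterI _ _ aeP _ _ (ae_completion cphi) (ae_completion lphi)).
apply: (@filterS _ _ aeP) => w [[kw lw] [cw lipw]].
exact: dual_le_W1.
Qed.

Let integral_kernel_measurable (h : R.-pker (borel Omega) ~> (borel X))
    (f : X -> R) : continuous f ->
  measurable_fun setT (fun w => \int[h w]_(x in K) (f x)%:E)%E.
Proof.
move=> cf.
have mf : measurable_fun setT ((EFin \o f) \_ K : borel X -> \bar R).
  apply/measurable_restrict => //; rewrite setTI.
  apply/measurable_EFinP; apply: within_continuous_borel => //.
  exact: continuous_subspaceT.
rewrite (_ : (fun _ => _) = (fun w => \int[h w]_x ((EFin \o f) \_ K)^\+ x -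
    \int[h w]_x ((EFin \o f) \_ K)^\- x)%E); last first.
  by apply/funext => w; rewrite integral_mkcond integralE.
apply: emeasurable_funB; apply: measurable_fun_integral_kernel => //.
- by move=> U mU; exact: measurable_kernel.
- exact: measurable_funepos.
- by move=> U mU; exact: measurable_kernel.
- exact: measurable_funeneg.
Qed.

Section approximation.
Variables (e : R) (n : nat) (x : 'I_n.+1 -> X).
Hypothesis e0 : 0 < e.
Hypothesis xK : forall y, K y -> exists i, `|y - x i| < e.

(** The countable family of competitors, indexed by codes of rational vectors; a number that codes
    nothing stands for the zero vector. *)
Let F m : X -> R :=
  cone_min x (ratr \o odflt [ffun=> 0] (unpickle m : option {ffun 'I_n.+1 -> rat})).

Let G m w : \bar R :=
  (\int[k w]_(y in K) (F m y)%:E - \int[l w]_(y in K) (F m y)%:E)%E.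

Let mG m : measurable_fun setT (G m).
Proof.
by apply: emeasurable_funB; apply: integral_kernel_measurable;
  exact: cone_min_continuous.
Qed.

Let W1_le_G w : k w (~` K) = 0%E -> l w (~` K) = 0%E ->
  exists m, (W1 (k w) (l w) <= G m w + (6 * e)%:E)%E.
Proof.
move=> kw lw.
pose pk : probability (borel X) R := unit_mass (prob_kernel w : k w setT = 1%E).
pose pl : probability (borel X) R := unit_mass (prob_kernel w : l w setT = 1%E).
have [s] := @W1_le_cone_min _ _ X_separable _ _ _ _ cK e0 xK pk pl kw lw.
by exists (pickle s); rewrite /G /F pickleK.
Qed.

Let G_le_W1 m w : k w (~` K) = 0%E -> l w (~` K) = 0%E ->
  (G m w <= W1 (k w) (l w))%E.
Proof.
move=> kw lw; apply: dual_le_W1 => //.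
- apply: continuous_subspaceT; exact: cone_min_continuous.
- by move=> [a b] _ /=; rewrite mul1r; exact: cone_min_lipschitz.
Qed.

Lemma Wpi1_le_dual_pairing : exists2 phi, Lippi1 P K phi &
  (Wpi1 P k l <= dual_pairing P K k l phi + (12 * e)%:E)%E.
Proof.
(* Near optimality is tested against all [G i] instead of [W1], which makes [S m] a countable
   intersection of measurable sets. *)
pose S m : set (borel Omega) := \bigcap_i [set w | (G i w <= G m w + (6 * e)%:E)%E].
have mS m : measurable (S m).
  apply: bigcapT_measurable => i; rewrite -[X in measurable X]setTI.
  by apply: measurable_lee => //; exact: emeasurable_funD.
have [N mN SN] := measurable_least_index mS.
exists (fun w => F (N w)).
  split; last first.
    apply: aeW => w [a b] _ /=; rewrite mul1r; exact: cone_min_lipschitz.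
  split; last first.
    apply: aeW => w; apply: continuous_subspaceT; exact: cone_min_continuous.
  move=> y _; apply: measurable_fun_completed.
  exact: (@measurable_fun_index _ _ _ _ _ (fun m _ => F m y)).
rewrite /dual_pairing -/(G _ _).
pose g w := G (N w) w.
have mg : measurable_fun [set: completed P] g.
  by apply: measurable_fun_completed; exact: measurable_fun_index.
have P1 : completion P setT = 1%E.
  by apply: etrans (probability_setT P); exact: completion_measurableE.
(* One [6 * e] comes from the approximation of [W1] by some [G m], the other from the comparison of
   [G m] with the selected [G (N w)]. *)
have WG : {ae completion P, forall w, (W1 (k w) (l w) <= g w + (12 * e)%:E)%E}.
  move: klK; apply: (@filterS _ _ aeP) => w [kw lw].
  have [m Wm] := W1_le_G kw lw.
  have SNw : S (N w) w.
    by apply: SN; exists m => i _; exact: le_trans (G_le_W1 i kw lw) Wm.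
  have GN : (G m w <= g w + (6 * e)%:E)%E := SNw m I.
  apply: (le_trans Wm); apply: (le_trans (leeD2r _ GN)).
  by rewrite -addeA -EFinD (_ : 6 * e + 6 * e = 12 * e)//; ring.
have [M0 [_ KM0]] := compact_bounded K_compact.
have KM y : K y -> `|y| <= M0 + 1 by apply: KM0; rewrite ltrDl.
set M := M0 + 1 in KM.
(* On [K], the 1-Lipschitz [F m] stays within [M] of [F m 0]. This constant cancels in [G m], so [g]
   is bounded by [2 * M] whatever index is selected. *)
have intF m w (h : R.-pker (borel Omega) ~> (borel X)) : h w (~` K) = 0%E ->
    ((F m 0 - M)%:E <= \int[h w]_(y in K) (F m y)%:E <= (F m 0 + M)%:E)%E.
  move=> hw; rewrite (integral_concentrated mK hw).
  have FM y : K y -> `|F m y - F m 0| <= M.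
    by move=> Ky; rewrite (le_trans (cone_min_lipschitz _ _ _ _))// subr0 KM.
  have hcst c : (\int[h w]_y c%:E = c%:E)%E.
    by rewrite integral_cst//= prob_kernel mule1.
  apply/andP; split; [rewrite -[leLHS]hcst|rewrite -[leRHS]hcst];
    apply: (le_integral_concentrated mK hw) => y /FM;
    by rewrite lee_fin ler_norml; lra.
have intg : (completion P).-integrable setT g.
  apply/integrableP; split => //.
  apply: (@le_lt_trans _ _ (\int[completion P]_w (2 * M)%:E)%E); last first.
    by rewrite integral_cst//= P1 mule1 ltry.
  apply: ae_le_integral_lower; move: klK; apply: (@filterS _ _ aeP) => w [kw lw].
  have /andP[k1 k2] := intF (N w) _ _ kw.
  have /andP[l1 l2] := intF (N w) _ _ lw.
  rewrite /g /G; move: k1 k2 l1 l2.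
  case: (\int[k w]_(y in K) _)%E => [a| |]//.
  case: (\int[l w]_(y in K) _)%E => [b| |]//.
  by rewrite -EFinB /= !lee_fin ler_norml; lra.
have -> : (12 * e)%:E = (\int[completion P]_w (12 * e)%:E)%E.
  by rewrite integral_cst//= P1 mule1.
rewrite -integralD//; last first.
  by apply/integrableP; split => //; rewrite integral_cst//= P1 mule1 ltry.
exact: ae_le_integral_lower.
Qed.

End approximation.

End fibered_duality.

Theorem proposition3p6 (R : realType)
    (Omega : ptopologicalType) (Omega_polish : polish R Omega)
    (P : probability (borel Omega) R)
    (X : completeNormedModType R) (X_separable : separable X)
    (K : set X) (K_compact : compact K)
    (mu nu : probability (borel (Omega * X)%type) R)
    (Kmu : measures_over P K mu) (Knu : measures_over P K nu)
    (mu_ nu_ : R.-pker (borel Omega) ~> (borel X))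
    (dmu : disintegration P K mu mu_) (dnu : disintegration P K nu nu_) :
  Wpi1 P mu_ nu_ =
  ereal_sup [set dual_pairing P K mu_ nu_ phi | phi in Lippi1 P K].
Proof.
have [kK _] := dmu; have [lK _] := dnu.
apply/eqP; rewrite eq_le; apply/andP; split; last first.
  by apply: ge_ereal_sup => _ [phi Lphi <-]; exact: dual_pairing_le_Wpi1.
apply/lee_addgt0Pr => e e0.
(* The selection loses twelve times the mesh of the net. *)
have e12 : 0 < e / 12 by rewrite divr_gt0.
have [n [x xK]] := compact_finite_net K_compact e12.
have [phi Lphi] := Wpi1_le_dual_pairing X_separable K_compact kK lK e12 xK.
rewrite mulrC divfK// => /le_trans; apply.
by rewrite leeD2r//; apply: ereal_sup_ubound; exists phi.
Qed.
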